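(* Consider the control system $\dot z=-z,\ \dot c=0,\ \dot y=-y+zu$, $u\in U=[-1,1]$, on $M=\mathbb R^3$ (coordinates $(z,c,y)$) with the Euclidean metric. Let $K:=\{(1,c,0):c\in C\}$, let $Q:=\{(z,c,F(z,c)):z\in[0,1],\ c\in C\}$, and for $n\ge1$ let $K_n:=\{(1,c,0):c\in C_n\}$, where $C$ is the middle-third Cantor set and $C_n$, $F$ are defined in the context. Then the sets $K_n\subseteq Q$ converge to $K$ in the Hausdorff metric, but $\liminf_{n\to\infty}h_{\mathrm{inv}}^*(K_n,Q)<h_{\mathrm{inv}}^*(K,Q)$. More precisely, $h_{\mathrm{inv}}^*(K_n,Q)=0$ for every $n$, while $h_{\mathrm{inv}}^*(K,Q)=\log2$. In particular, with the target set $Q$ fixed, strict invariance entropy is not lower semicontinuous in the initial set with respect to the Hausdorff metric on compact subsets of $Q$.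
   Context: Coding. $\Sigma:=\{-1,1\}^{\mathbb N}$, with indices $j\ge 1$; $\pi:\Sigma\to[0,1]$, $\pi(\omega):=\sum_{j=1}^\infty\frac{\omega_j+1}{3^j}$, which is injective; $C:=\pi(\Sigma)$ is the standard middle-third Cantor set. For $c\in C$, $\sigma(c)=(\sigma_1(c),\sigma_2(c),\ldots):=\pi^{-1}(c)\in\Sigma$. For a word $\omega=(\omega_1,\ldots,\omega_n)\in\{-1,1\}^n$, put $\omega^+:=(\omega_1,\ldots,\omega_n,1,1,1,\ldots)\in\Sigma$ and $c_\omega^+:=\pi(\omega^+)$; then $C_n:=\{c_\omega^+:\omega\in\{-1,1\}^n\}$. Matching function. For $c\in C$ let $a(t,c):=\sigma_j(c)$ for $t\in[j-1,j)$, $j\ge1$; $q(t,c):=\int_0^t a(s,c)\,ds$ for $t\ge0$; and define $F:[0,1]\times C\to\mathbb R$ by $F(z,c):=z\,q(-\log z,c)$ for $z>0$ and $F(0,c):=0$. Controls and trajectories. $\log$ is the natural logarithm. Admissible controls are the Lebesgue measurable functions $u:[0,\infty)\to U=[-1,1]$, identified when equal a.e.; their set is $\mathcal U$. For $x\in M$, $u\in\mathcal U$, $\varphi(t,x,u)$, $t\ge 0$, denotes the Carathéodory solution with initial value $x$ at time $0$ under control $u$. Strict invariance entropy. Let $Q\subseteq M$ and $K'\subseteq Q$ be compact and $T>0$. A finite $S\subseteq\mathcal U$ is $(T,K',Q)$-spanning if for every $x\in K'$ there is $u\in S$ with $\varphi(t,x,u)\in Q$ for all $t\in[0,T]$; $r_{\mathrm{inv}}^*(T,K',Q)$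 is the smallest cardinality of such a set ($\infty$ if none exists). With $\log\infty=\infty$, $h_{\mathrm{inv}}^*(K',Q):=\limsup_{T\to\infty}\frac1T\log r_{\mathrm{inv}}^*(T,K',Q)$. Hausdorff metric. For nonempty compact $A,B$ in a metric space, $d_H(A,B):=\max\{\sup_{a\in A}\operatorname{dist}(a,B),\sup_{b\in B}\operatorname{dist}(b,A)\}$. *)

(* Defs.v *)
From mathcomp Require Export all_boot all_order all_algebra.
From mathcomp Require Export all_classical all_reals all_analysis.
Export Order.TTheory GRing.Theory Num.Theory.
Export numFieldNormedType.Exports.

Set Implicit Arguments.
Unset Strict Implicit.
Unset Printing Implicit Defensive.

Local Open Scope classical_set_scope.
Local Open Scope ring_scope.

(* Sequences indexed by j >= 1 in the mathematics are indexed from 0 here: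
   [w j] stands for omega_(j+1). *)

Section Coding.
Variable R : realType.

Definition Sigma : set (nat -> R) :=
  [set w | forall j, w j = -1 \/ w j = 1].

Definition coding (w : nat -> R) : R :=
  limn (series (fun j => (w j + 1) / 3 ^+ j.+1)).

Definition cantor_set : set R := coding @` Sigma.

(* The default value (the constant sequence 1) is only used outside
   [cantor_set]; [coding] is injective on [Sigma]. *)
Definition sigma : R -> nat -> R := 'pinv_(fun=> fun=> 1) Sigma coding.

Definition words (n : nat) : set (n.-tuple R) :=
  [set w | forall i, tnth w i = -1 \/ tnth w i = 1].

(* The default value 1 of [nth] supplies the infinite tail of 1s. *)
Definition plus_ext (n : nat) (w : n.-tuple R) : nat -> R := nth 1 w.

Definition cantor_approx (n : nat) : set R :=
  [set coding (plus_ext w) | w in @words n].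

End Coding.
Arguments cantor_set : clear implicits.
Arguments cantor_approx : clear implicits.

Section Matching.
Variable R : realType.

(* t \in [j-1, j) iff [truncn t] = j-1, for t >= 0. *)
Definition match_a (t c : R) : R := sigma c (Num.truncn t).

Definition match_q (t c : R) : R :=
  \int[lebesgue_measure]_(s in `[0, t]) match_a s c.

Definition match_F (z c : R) : R :=
  if 0 < z then z * match_q (- ln z) c else 0.

End Matching.

Section ControlSystems.
Variables (R : realType) (d : nat).
Local Notation M := ('rV[R]_d.+1).
Implicit Types (f : M -> R -> M) (U : set R) (u v : R -> R) (Q K : set M).

Definition abs_continuous (V : normedModType R) (a b : R) (g : R -> V) :=
  forall e : R, 0 < e -> exists2 del : R, 0 < del &
    forall (n : nat) (l r : 'I_n -> R),
      (forall i, a <= l i /\ l i <= r i /\ r i <= b) ->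
      trivIset [set: 'I_n] (fun i => `]l i, r i[%classic) ->
      \sum_i (r i - l i) < del ->
      \sum_i `|g (r i) - g (l i)| < e.

(* Measurability with respect to the sigma-algebra of Lebesgue (that is,
   Caratheodory) measurable sets on the domain, Borel on the codomain. *)
Definition Lebesgue_measurable_fun (D : set R) (u : R -> R) :=
  @measurable_fun _ _ (caratheodory_type (@wlength R idfun)^*%mu)
    (measurableTypeR R) D u.

Definition admissible U : set (R -> R) :=
  [set u | Lebesgue_measurable_fun `[0, +oo[%classic u /\
           forall t, 0 <= t -> U (u t)].

(* A control is an a.e.-equality class on [0, +oo[; in particular the values
   of its representatives at negative times are irrelevant. *)
Definition control_class U u : set (R -> R) :=
  [set v | admissible U v /\ ae_eq (@lebesgue_measure R) `[0, +oo[%classic u v].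

Definition controls U : set (set (R -> R)) :=
  [set control_class U u | u in admissible U].

(* [phi] restricted to [0, +oo[ is a Caratheodory solution of
   x' = f(x, u) with x(0) = x. *)
Definition solution f (x : M) u (phi : R -> M) :=
  [/\ phi 0 = x,
      forall T, 0 < T -> abs_continuous 0 T phi &
      {ae @lebesgue_measure R, forall t : R, 0 <= t ->
        is_derive (t : R^o) 1 (phi : R^o -> M) (f (phi t) (u t))}].

Definition spanning f U (T : R) K Q (S : set (set (R -> R))) :=
  [/\ finite_set S, S `<=` controls U &
      forall x, K x -> exists2 w, S w &
        exists u phi, [/\ w u, solution f x u phi &
          forall t, 0 <= t <= T -> Q (phi t)]].

Definition r_inv f U (T : R) K Q : \bar R :=
  ereal_inf [set (n%:R)%:E | n in
    [set n | exists2 S, spanning f U T K Q S & (S #= `I_n)%card]].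

Definition h_inv f U K Q : \bar R :=
  limf_esup (fun T : R => ((T^-1)%:E * lne (r_inv f U T K Q))%E) (+oo)%R.

End ControlSystems.

Section Hausdorff.
Variables (R : realType) (n : nat).
Local Notation M := ('rV[R]_n.+1).
Implicit Types (x y : M) (A B Q : set M).

Definition euclidean_dist x y : R :=
  Num.sqrt (\sum_i (x 0 i - y 0 i) ^+ 2).

(* Real-valued [inf] and [sup]: meaningful for nonempty compact sets. *)
Definition dist_to x A : R := inf [set euclidean_dist x y | y in A].

Definition hausdorff_dist A B : R :=
  Num.max (sup [set dist_to x B | x in A]) (sup [set dist_to x A | x in B]).

(* Compactness in the library's topology of 'rV, which is the Euclidean one. *)
Definition compact_subsets Q : set (set M) :=
  [set A | [/\ A !=set0, compact A & A `<=` Q]].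

Definition hausdorff_lower_semicontinuous Q (h : set M -> \bar R) :=
  forall A (a : R), compact_subsets Q A -> (a%:E < h A)%E ->
    exists2 e : R, 0 < e & forall B, compact_subsets Q B ->
      hausdorff_dist A B < e -> (a%:E < h B)%E.

End Hausdorff.

Section Example.
Variable R : realType.

Definition vec3 (z c y : R) : 'rV[R]_3 := \row_i [:: z; c; y]`_i.

Definition ex_rhs (x : 'rV[R]_3) (u : R) : 'rV[R]_3 :=
  vec3 (- x 0 0) 0 (- x 0 2 + x 0 0 * u).

Definition ex_U : set R := `[-1, 1]%classic.

Definition ex_K : set 'rV[R]_3 := [set vec3 1 c 0 | c in cantor_set R].

Definition ex_Kn (n : nat) : set 'rV[R]_3 :=
  [set vec3 1 c 0 | c in cantor_approx R n].

Definition ex_Q : set 'rV[R]_3 :=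
  [set vec3 p.1 p.2 (match_F p.1 p.2) | p in `[0, 1]%classic `*` cantor_set R].

Definition ex_h : set 'rV[R]_3 -> set 'rV[R]_3 -> \bar R := h_inv ex_rhs ex_U.

End Example.
Arguments ex_K : clear implicits.
Arguments ex_Kn : clear implicits.
Arguments ex_Q : clear implicits.

(* Main.v *)
Require Import Defs.
From mathcomp Require Import measurable_realfun lra ring.

(* Along a trajectory starting at (1, c, 0) one has z = exp(-t) and
   y exp(t) = \int_0^t u, so staying in Q on [0, T] forces
   \int_0^t u = q(t, c) for t <= T, and the increments of q(., c) over unit
   intervals are the signs of c. Hence a control follows initial points with a
   single initial word of length floor(T), so 2^floor(T) controls are needed
   for K, and the 2^ceil(T) step controls suffice; for K_n the 2^n step
   controls of its points work for every T. *)

Set Implicit Arguments.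
Unset Strict Implicit.
Unset Printing Implicit Defensive.

Local Open Scope classical_set_scope.
Local Open Scope ring_scope.

(** * Ternary expansions and the Cantor set *)

Section Coding.
Variable R : realType.
Implicit Types w v : nat -> R.

(** The integral of a control is never formed. The lower bound for K compares two solutions driven
    by the same control class: their y-coordinates differ by a function h with h' = -h almost
    everywhere, and the analytic burden is that an absolutely continuous function with zero
    derivative almost everywhere is constant. The upper bounds use explicit solutions. The integral
    in [match_q] is traded for a finite sum of ramps, [walk], which makes Lipschitz bounds and the
    dependence on finitely many letters visible. Closeness of K_n to K does not carry over to the
    entropies because T tends to infinity while n stays fixed. Compactness of Q hinges on the
    continuity of F at z = 0, where no finite number of letters determines F nearby; there a bound
    uniform in the letters takes over. *)

Definition tail w : nat -> R := fun j => w j.+1.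

Definition ternary w : R^nat := fun j => (w j + 1) / 3 ^+ j.+1.

Lemma Sigma_tail w : Sigma w -> Sigma (tail w).
Proof. by move=> Sw j; exact: Sw. Qed.

Lemma Sigma_bound w j : Sigma w -> -1 <= w j <= 1.
Proof. by move=> /(_ j) [->|->]; apply/andP; split; lra. Qed.

Lemma series_ternaryS w n : series (ternary w) n.+1 =
  (w 0%N + 1) / 3 + series (ternary (tail w)) n / 3.
Proof.
rewrite /series /= big_nat_recl// {1}/ternary expr1; congr (_ + _).
rewrite mulr_suml; apply: eq_bigr => i _.
by rewrite /ternary /tail [in LHS]exprSr invfM mulrA.
Qed.

Lemma series_ternary_bound w n : Sigma w -> 0 <= series (ternary w) n <= 1.
Proof.
elim: n w => [w _|n IHn w Sw]; first by rewrite /series /= big_geq// lexx ler01.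
rewrite series_ternaryS.
have /andP[? ?] := Sigma_bound 0 Sw.
have /andP[? ?] := IHn _ (Sigma_tail Sw).
by apply/andP; split; lra.
Qed.

Lemma is_cvg_series_ternary w : Sigma w -> cvgn (series (ternary w)).
Proof.
move=> Sw; apply: nondecreasing_is_cvgn.
  apply/nondecreasing_seqP => n; rewrite /series /= big_nat_recr//= lerDl.
  have /andP[? ?] := Sigma_bound n Sw.
  by rewrite /ternary divr_ge0 ?exprn_ge0//; lra.
by exists 1 => _ [n _ <-]; have /andP[] := series_ternary_bound n Sw.
Qed.

(** Self-similarity of the Cantor set, as the limit of the recursion for partial sums; injectivity
    and closeness of codes are inductions along it. *)
Lemma codingS w : Sigma w ->
  coding w = (w 0%N + 1) / 3 + coding (tail w) / 3.
Proof.
move=> Sw; apply/cvg_lim => //.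
rewrite -(cvg_shiftS (series (ternary w))).
rewrite (_ : [sequence _]_n = fun n =>
  (w 0%N + 1) / 3 + series (ternary (tail w)) n / 3); last first.
  by apply/funext => n; exact: series_ternaryS.
apply: cvgD; first exact: cvg_cst.
by apply: cvgMr_tmp; apply: is_cvg_series_ternary; exact: Sigma_tail.
Qed.

Lemma coding_bound w : Sigma w -> 0 <= coding w <= 1.
Proof.
move=> Sw; have cw := is_cvg_series_ternary Sw; apply/andP; split.
  by apply: limr_ge => //; near=> n; have /andP[] := series_ternary_bound n Sw.
by apply: limr_le => //; near=> n; have /andP[] := series_ternary_bound n Sw.
Unshelve. all: by end_near. Qed.

(** Different first letters put the codes 2/3 apart, while the tails, divided by 3, differ by at
    most 1/3; so the first letters agree and can be stripped. *)
Lemma coding_inj w v : Sigma w -> Sigma v -> coding w = coding v -> w = v.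
Proof.
move=> Sw Sv wv; apply/funext => j.
elim: j w v Sw Sv wv => [|j IHj] w v Sw Sv wv.
  move: wv; rewrite (codingS Sw) (codingS Sv).
  have /andP[? ?] := coding_bound (Sigma_tail Sw).
  have /andP[? ?] := coding_bound (Sigma_tail Sv).
  by case: (Sw 0%N) => ->; case: (Sv 0%N) => -> //; lra.
apply: (IHj (tail w) (tail v)); [exact: Sigma_tail..|].
move: wv; rewrite (codingS Sw) (codingS Sv).
have /andP[? ?] := coding_bound (Sigma_tail Sw).
have /andP[? ?] := coding_bound (Sigma_tail Sv).
by case: (Sw 0%N) => ->; case: (Sv 0%N) => ->; lra.
Qed.

(** Each common leading letter contracts the distance by 3, starting from the diameter bound 1. *)
Lemma coding_near w v n : Sigma w -> Sigma v ->
  (forall j, (j < n)%N -> w j = v j) -> `|coding w - coding v| <= 3^-1 ^+ n.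
Proof.
elim: n w v => [|n IHn] w v Sw Sv wv.
  have /andP[? ?] := coding_bound Sw; have /andP[? ?] := coding_bound Sv.
  by rewrite expr0 ler_norml; apply/andP; split; lra.
rewrite (codingS Sw) (codingS Sv) (wv 0%N)// [X in `|X|](_ : _ =
  3^-1 * (coding (tail w) - coding (tail v))); last by field.
rewrite normrM ger0_norm// exprS ler_wpM2l//.
by apply: IHn; [exact: Sigma_tail..|move=> j jn; exact: wv].
Qed.

Lemma sigmaK w : Sigma w -> sigma (coding w) = w.
Proof.
move=> Sw; rewrite /sigma; apply: pinvKV; last exact: mem_set.
by move=> x y /set_mem Sx /set_mem Sy; exact: coding_inj.
Qed.

Lemma cantorP (c : R) : cantor_set R c -> Sigma (sigma c) /\ coding (sigma c) = c.
Proof. by move=> [w Sw <-]; rewrite sigmaK. Qed.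

(** Working with functions instead of tuples makes C_n the image of all of [Sigma], so that a point
    of C and its approximation are compared letter by letter. *)
Definition truncate n w : nat -> R := fun j => if (j < n)%N then w j else 1.

Lemma Sigma_truncate n w : Sigma w -> Sigma (truncate n w).
Proof. by move=> Sw j; rewrite /truncate; case: ifP => _; [exact: Sw|right]. Qed.

Lemma cantor_approxE n :
  cantor_approx R n = [set coding (truncate n w) | w in @Sigma R].
Proof.
apply/seteqP; split=> [_ [w ww <-]|_ [w Sw <-]].
  have Ew : truncate n (plus_ext w) = plus_ext w.
    apply/funext => j; rewrite /truncate /plus_ext; case: ltnP => // nj.
    by rewrite nth_default// size_tuple.
  exists (plus_ext w); last by rewrite Ew.
  move=> j; rewrite /plus_ext; case: (ltnP j n) => jn; last first.
    by right; rewrite nth_default// size_tuple.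
  by have := ww (Ordinal jn); rewrite (tnth_nth 1).
exists [tuple w i | i < n]; first by move=> i; rewrite tnth_mktuple; exact: Sw.
congr coding; apply/funext => j; rewrite /truncate /plus_ext.
case: ltnP => jn; last by rewrite nth_default// size_tuple.
by rewrite -(tnth_nth _ _ (Ordinal jn)) tnth_mktuple.
Qed.

Lemma cantor_approx_sub n : cantor_approx R n `<=` cantor_set R.
Proof.
by rewrite cantor_approxE => _ [w Sw <-]; exists (truncate n w) => //;
  exact: Sigma_truncate.
Qed.

End Coding.

(** * Primitives of sign sequences and the function q *)

Section Walk.
Variable R : realType.
Implicit Types (w v : nat -> R) (x y s t : R).

(** [clip (t - j%:R)] is the length of the part of [j, j+1] lying below t, so weighting these ramps
    by letters integrates a step function. *)
Definition clip x : R := Num.max 0 (Num.min 1 x).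

Variant clip_spec x : R -> Type :=
| ClipLow of x <= 0 : clip_spec x 0
| ClipMid of 0 <= x & x <= 1 : clip_spec x x
| ClipHigh of 1 <= x : clip_spec x 1.

Lemma clipP x : clip_spec x (clip x).
Proof.
rewrite /clip; have [x1|/ltW x1] := lerP x 1.
  by have [x0|/ltW x0] := lerP x 0; constructor.
by rewrite max_r//; constructor.
Qed.

Lemma clip_lipschitz x y : `|clip x - clip y| <= `|x - y|.
Proof.
have /ler_normlP[h1 h2] := lexx `|x - y|; have h0 := normr_ge0 (x - y).
by rewrite ler_norml; case: (clipP x) => *; case: (clipP y) => *; apply/andP; split; lra.
Qed.

(** Extending [0, a] by one unit interval captures [clip (t - a)] more of [0, t]; this is the
    induction step of [walk_tail]. *)
Lemma clip_step (a t : R) : 0 <= a ->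
  Num.max 0 (Num.min a t) + clip (t - a) <= Num.max 0 (Num.min (a + 1) t).
Proof.
move=> a0; have [ta|lt_at] := leP t a.
  rewrite (@min_r _ _ (a + 1)); last lra.
  by have -> : clip (t - a) = 0; [case: clipP => *; lra|rewrite addr0].
rewrite (@max_r _ _ 0 a)//; case: clipP => *; first lra.
  by rewrite min_r ?max_r; lra.
by rewrite min_l ?max_r; lra.
Qed.

Definition walk w n t : R := \sum_(j < n) w j * clip (t - j%:R).

Lemma walkS w n t : walk w n.+1 t = walk w n t + w n * clip (t - n%:R).
Proof. by rewrite /walk big_ord_recr. Qed.

Lemma walk_stable w t n m : t <= n%:R -> (n <= m)%N -> walk w m t = walk w n t.
Proof.
move=> tn; elim: m => [|m IHm]; first by rewrite leqn0 => /eqP ->.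
rewrite leq_eqVlt => /predU1P[->//|/[!ltnS] nm]; rewrite walkS IHm//.
have nmR : n%:R <= m%:R :> R by rewrite ler_nat.
by have -> : clip (t - m%:R) = 0; [case: clipP => *; lra|rewrite mulr0 addr0].
Qed.

Lemma walk_itv w n t : n%:R <= t <= n.+1%:R ->
  walk w n.+1 t = \sum_(j < n) w j + w n * (t - n%:R).
Proof.
rewrite -natr1 => /andP[nt tn]; rewrite walkS; congr (_ + _); last first.
  by congr (_ * _); case: (clipP (t - n%:R)) => *; lra.
apply: eq_bigr => -[j /= jn] _.
have : j.+1%:R <= n%:R :> R by rewrite ler_nat.
rewrite -natr1 => ?.
by have -> : clip (t - j%:R) = 1; [case: clipP => *; lra|rewrite mulr1].
Qed.

Lemma eq_walk w v n t : (forall j, (j < n)%N -> w j = v j) -> walk w n t = walk v n t.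
Proof. by move=> wv; apply: eq_bigr => i _; rewrite wv. Qed.

(** Each of the n ramps is 1-Lipschitz and has weight of modulus 1. *)
Lemma walk_lipschitz w n s t : Sigma w -> `|walk w n s - walk w n t| <= n%:R * `|s - t|.
Proof.
move=> Sw; elim: n => [|n IHn]; first by rewrite /walk !big_ord0 subrr normr0 mul0r.
rewrite !walkS opprD addrACA -mulrBr (le_trans (ler_normD _ _))//.
rewrite -natr1 mulrDl mul1r lerD// normrM.
have -> : `|w n| = 1 by case: (Sw n) => ->; rewrite ?normrN normr1.
rewrite mul1r (le_trans (clip_lipschitz _ _))//.
by rewrite opprB addrA subrK.
Qed.

Lemma walk_tail w n m t : Sigma w -> (n <= m)%N ->
  `|walk w m t - walk w n t| <= Num.max 0 (t - n%:R).
Proof.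
move=> Sw nm.
(* The bound is sharpened by the number of extra letters, so that induction on [m] can add one unit
   interval at a time. *)
suff : `|walk w m t - walk w n t| <= Num.max 0 (Num.min (m%:R - n%:R) (t - n%:R)).
  by move=> /le_trans; apply; rewrite ge_max !le_max !ge_min !lexx !orbT.
elim: m nm => [|m IHm].
  by rewrite leqn0 => /eqP ->; rewrite subrr normr0 le_max lexx.
rewrite leq_eqVlt => /predU1P[<-|/[!ltnS] nm]; first by rewrite subrr normr0 le_max lexx.
rewrite walkS addrAC (le_trans (ler_normD _ _))// normrM.
have -> : `|w m| = 1 by case: (Sw m) => ->; rewrite ?normrN normr1.
have c0 : 0 <= clip (t - m%:R) by case: clipP.
rewrite mul1r ger0_norm//; apply: (le_trans (lerD (IHm nm) (lexx _))).
have -> : t - m%:R = (t - n%:R) - (m%:R - n%:R) by ring.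
have -> : m.+1%:R - n%:R = (m%:R - n%:R) + 1 :> R by rewrite -natr1; ring.
by apply: clip_step; rewrite subr_ge0 ler_nat.
Qed.

Lemma walk0 w n : walk w n 0 = 0.
Proof. by rewrite (@walk_stable _ _ 0 n)// /walk big_ord0. Qed.

Lemma walk_nat w n : walk w n n%:R = \sum_(j < n) w j.
Proof.
rewrite -(@walk_stable w _ n n.+1)// walk_itv ?subrr ?mulr0 ?addr0//.
by rewrite lexx ler_nat/=.
Qed.

(** A letter is the increment of the walk over its unit interval, so integer times suffice to
    recover the word. *)
Lemma eq_walk_word w v n : (forall m, (m <= n)%N -> walk w m m%:R = walk v m m%:R) ->
  forall j, (j < n)%N -> w j = v j.
Proof.
move=> wv j jn; have := wv j.+1 jn; rewrite !walk_nat !big_ord_recr/=.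
by rewrite -!walk_nat wv 1?ltnW// => /addrI.
Qed.

(* [match_a s c] is [step (sigma c) s]. *)
Definition step w s : R := w (Num.truncn s).

Lemma step_preimage w (Y : set R) :
  `[0, +oo[ `&` step w @^-1` Y =
  \bigcup_(n in [set n | Y (w n)]) `[n%:R, n.+1%:R[%classic.
Proof.
apply/seteqP; split=> [s /=|s [n /= Yn]].
  rewrite in_itv/= andbT => -[s0 Ys]; exists (Num.truncn s) => //=.
  by rewrite in_itv/= truncn_itv.
rewrite /= !in_itv/= andbT => sn; split.
  by case/andP: sn => + _; apply: le_trans.
by rewrite /step (truncn_def sn).
Qed.

Lemma measurable_step w : measurable_fun (`[0, +oo[%classic : set R) (step w).
Proof. by move=> _ Y mY; rewrite step_preimage; apply: bigcup_measurable. Qed.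

Lemma admissible_step w : Sigma w -> admissible (@ex_U R) (step w).
Proof.
move=> Sw; split.
  by move=> _ Y mY; exact: sub_caratheodory (@measurable_step w _ Y mY).
by move=> t _; rewrite /ex_U /= in_itv/=; exact: Sigma_bound.
Qed.

Lemma integrable_step w t (i : interval R) : Sigma w -> [set` i] `<=` `[0, t] ->
  (@lebesgue_measure R).-integrable [set` i] (EFin \o step w).
Proof.
move=> Sw it; apply: (@integrableS _ _ R lebesgue_measure (`[0, t]%classic : set R) [set` i]
  (EFin \o step w)) => //.
apply: measurable_bounded_integrable => //.
- by rewrite /= lebesgue_measure_itv/=; case: ifP => // _; rewrite -EFinB ltry.
- apply: measurable_funS (measurable_step w) => //.
  by move=> x /=; rewrite !in_itv/= andbT => /andP[].
- exists 1; split=> // M M1 x _; apply: le_trans (ltW M1).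
  by rewrite /step; case: (Sw (Num.truncn x)) => ->; rewrite ?normrN normr1.
Qed.

Lemma match_qE c n t : cantor_set R c -> 0 <= t <= n%:R ->
  match_q t c = walk (sigma c) n t.
Proof.
move=> /cantorP[Sw _].
change (match_q t c) with (\int[lebesgue_measure]_(s in `[0, t]) step (sigma c) s).
move: (sigma c) Sw => w Sw; elim: n t => [|n IHn] t /andP[t0 tn].
  have -> : t = 0 by apply/eqP; rewrite eq_le t0 tn.
  by rewrite set_itv1 Rintegral_set1 walk0.
have [tn'|/ltW nt] := leP t n%:R.
  by rewrite (@walk_stable _ _ n)//; apply: IHn; rewrite t0.
rewrite walk_itv ?nt// -walk_nat.
have -> : \int[lebesgue_measure]_(s in `[0, t]) step w s =
  (\int[lebesgue_measure]_(s in `[0, n%:R]) step w s) +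
  (\int[lebesgue_measure]_(s in `]n%:R, t]) step w s).
  rewrite -(@Rintegral_itvB _ (step w) (BLeft 0) (BRight t) n%:R)//.
  - by rewrite addrC subrK.
  - exact: (@integrable_step w t).
  - by rewrite bnd_simp.
congr (_ + _); first by apply: IHn; rewrite lexx ler0n.
(* The right endpoint is dropped: at t = n+1 the step function already takes the next letter. *)
rewrite -Rintegral_itv_bndo_bndc; last first.
  apply: (@integrable_step w t) => // s /=; rewrite !in_itv/= => /andP[ns /ltW ->].
  by rewrite andbT (le_trans _ (ltW ns)).
rewrite (@eq_Rintegral _ _ _ _ _ (cst (w n))); last first.
  move=> s; rewrite inE/= in_itv/= => /andP[ns st].
  by rewrite /step (@truncn_def _ _ n)// (ltW ns)/= (lt_le_trans st).
rewrite Rintegral_cst//= lebesgue_measure_itv/= lte_fin.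
by case: ltP => [_|tn']; [|have -> : t = n%:R by apply/eqP; rewrite eq_le tn' nt]; rewrite /= ?subrr.
Qed.

End Walk.

(** * Absolutely continuous functions with vanishing derivative *)

Section AbsolutelyContinuous.
Variable R : realType.
Implicit Types (a b x y s t e T : R).

(* Cousin's lemma: the hypothesis propagates [P] across each tag [s] of a
   gauge-fine tagged partition. *)
Lemma real_induction T (P : R -> Prop) : 0 <= T -> P 0 ->
  (forall s, 0 <= s <= T -> exists2 d : R, 0 < d & forall x y,
     0 <= x <= s -> s <= y <= T -> s - d < x -> y < s + d -> P x -> P y) ->
  P T.
Proof.
move=> T0 P0 step; pose E := [set x | 0 <= x <= T /\ P x].
have E0 : E 0 by split; rewrite ?lexx.
have ubE : ubound E T by move=> x [/andP[]].
have supE : has_sup E by split; [exists 0|exists T].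
have sE : 0 <= sup E <= T.
  by rewrite (ub_le_sup supE.2)//= ge_sup//; exists 0.
have [d d0 Pd] := step _ sE.
have [x [/andP[x0 xT] Px] dx] := sup_adherent d0 supE.
have xs : x <= sup E by apply: (ub_le_sup supE.2); split=> //; apply/andP.
pose y := Num.min T (sup E + d / 2).
have yT : y <= T by rewrite ge_min lexx.
have sy : sup E <= y by rewrite le_min; case/andP: sE => _ ->; lra.
have yd : y < sup E + d by rewrite gt_min; apply/orP; right; lra.
have Py : P y by apply: (Pd x y) => //; apply/andP.
have : y <= sup E.
  apply: (ub_le_sup supE.2); split=> //; apply/andP; split=> //.
  by apply: le_trans sy; case/andP: sE.
move: Py; rewrite /y; case: (lerP T (sup E + d / 2)) => // _ _; rewrite gerDl leNgt divr_gt0//.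
Qed.

Lemma abs_continuous1 (V : normedModType R) a b (g : R -> V) e :
  abs_continuous a b g -> 0 < e -> exists2 d : R, 0 < d &
  forall x y, a <= x <= y -> y <= b -> y - x < d -> `|g y - g x| < e.
Proof.
move=> acg e0; have [d d0 gd] := acg _ e0; exists d => // x y /andP[ax xy] yb xyd.
have := gd 1%N (fun=> x) (fun=> y); rewrite !big_ord1; apply=> //.
by move=> i j _ _ _; rewrite !ord1.
Qed.

(** Crossing one tag raises the bound by at most 1, and [real_induction] reaches T in finitely many
    such crossings. *)
Lemma abs_continuous_bounded (V : normedModType R) T (g : R -> V) : 0 <= T ->
  abs_continuous 0 T g -> exists2 M : R, 0 <= M & forall t, 0 <= t <= T -> `|g t| <= M.
Proof.
move=> T0 acg; have [d d0 gd] := abs_continuous1 acg ltr01.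
apply: (@real_induction T (fun x =>
  exists2 M : R, 0 <= M & forall t, 0 <= t <= x -> `|g t| <= M)) => //.
  by exists `|g 0| => // t; rewrite -eq_le => /eqP ->.
(* Both endpoints lie within [d / 2] of the tag, hence less than [d] apart. *)
move=> s _; exists (d / 2); first by rewrite divr_gt0.
move=> x y /andP[x0 xs] /andP[sy yT] sx ys [M M0 gM].
exists (M + 1); first lra.
move=> t /andP[t0 ty]; have [tx|/ltW xt] := leP t x.
  by have := gM t; rewrite t0 tx => /(_ isT) ?; lra.
have gx := gM x; rewrite x0 lexx in gx.
have gtx : `|g t - g x| < 1.
  by apply: gd; rewrite ?x0//; lra.
rewrite -(subrK (g x) (g t)) (le_trans (ler_normD _ _))// addrC lerD//; first exact: gx.
exact: ltW.
Qed.

Lemma abs_continuous_lipschitz (V : normedModType R) a b (g : R -> V) (k : R) :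
  (forall x y, a <= x <= y -> y <= b -> `|g y - g x| <= k * (y - x)) ->
  abs_continuous a b g.
Proof.
move=> gk e e0; pose k' := Num.max 1 k.
have k0 : 0 < k' by rewrite lt_max ltr01.
exists (e / k'); first by rewrite divr_gt0.
move=> n l r lr _; rewrite ltr_pdivlMr// => /le_lt_trans; apply.
rewrite mulr_suml; apply: ler_sum => i _; have [al [lri rb]] := lr i.
rewrite (le_trans (gk _ _ _ _)) ?al// mulrC ler_wpM2l ?subr_ge0//.
by rewrite le_max lexx orbT.
Qed.

Lemma abs_continuousM T (f g : R -> R) : 0 <= T ->
  abs_continuous (V := R^o) 0 T f -> abs_continuous (V := R^o) 0 T g ->
  abs_continuous (V := R^o) 0 T (fun t => f t * g t).
Proof.
move=> T0 acf acg e e0.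
have [Mf Mf0 fM] := abs_continuous_bounded T0 acf.
have [Mg Mg0 gM] := abs_continuous_bounded T0 acg.
(* The summand 1 keeps the divisor positive and makes the final inequality strict. *)
have e1 : 0 < e / (Mf + Mg + 1) by rewrite divr_gt0//; lra.
have [df df0 fd] := acf _ e1; have [dg dg0 gd] := acg _ e1.
exists (Num.min df dg); first by rewrite lt_min df0.
move=> n l r lr tlr; rewrite lt_min => /andP[lrf lrg].
have {}fd := fd _ _ _ lr tlr lrf; have {}gd := gd _ _ _ lr tlr lrg.
apply: (@le_lt_trans _ _ (Mf * (\sum_i `|g (r i) - g (l i)|) +
                          Mg * (\sum_i `|f (r i) - f (l i)|))).
  rewrite !mulr_sumr -big_split/=; apply: ler_sum => i _.
  have [l0 [lri rT]] := lr i.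
  have -> : f (r i) * g (r i) - f (l i) * g (l i) =
    f (r i) * (g (r i) - g (l i)) + g (l i) * (f (r i) - f (l i)) by ring.
  rewrite (le_trans (ler_normD _ _))// !normrM lerD// ler_wpM2r//.
    by apply: fM; rewrite rT (le_trans l0).
  by apply: gM; rewrite l0 (le_trans lri).
have -> : e = (Mf + Mg + 1) * (e / (Mf + Mg + 1)) by field; rewrite lt0r_neq0//; lra.
set e' := e / _ in e1 fd gd *.
apply: (@le_lt_trans _ _ (Mf * e' + Mg * e')); last by rewrite !mulrDl mul1r; lra.
by rewrite lerD// ler_wpM2l// ltW.
Qed.

Lemma is_derive0_near (g : R -> R) s e : is_derive (s : R^o) 1 (g : R^o -> R^o) 0 ->
  0 < e -> exists2 d : R, 0 < d & forall y, `|y - s| < d -> `|g y - g s| <= e * `|y - s|.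
Proof.
move=> [dg g0] e0; have : (fun h : R => h^-1 *: (((g : R^o -> R^o) \o shift (s : R^o))
    (h *: (1 : R^o)) - g s)) @ 0^' --> (0 : R^o).
  by rewrite -[X in _ --> X]g0; exact: dg.
move=> /cvgrPdist_le/(_ _ e0)[d /= d0 gd]; exists d => // y yd.
have [->|ys] := eqVneq y s; first by rewrite !subrr normr0 mulr0.
have := gd (y - s); rewrite /= sub0r normrN subr_eq0 => /(_ yd ys).
rewrite sub0r normrN [(_ *: 1)%R]mulr1 subrK normrM normfV ler_pdivrMl ?normr_gt0 ?subr_eq0//.
by rewrite mulrC.
Qed.

Lemma negligible_open_cover (Q : R -> Prop) e :
  {ae @lebesgue_measure R, forall t, Q t} -> 0 < e ->
  exists U : set R, [/\ open U, forall t, ~ Q t -> U t &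
    (@lebesgue_measure R U < e%:E)%E].
Proof.
(* The exceptional set itself may fail to be measurable; outer regularity is applied to a measurable
   null superset. *)
move=> aeQ e0; have [A [mA A0 QA]] : exists A : set R,
    [/\ measurable A, lebesgue_measure A = 0%E
      & forall t, ~ Q t -> A t].
  by case: aeQ => A [mA A0 QA]; exists A; split=> // t /QA.
have [|U [oU AU UA]] := @lebesgue_regularity_outer R A e mA _ e0.
  by rewrite /= A0.
have mU : measurable U by exact: open_measurable.
exists U; split=> // [t Qt|]; first by apply: AU; exact: QA.
have -> : (lebesgue_measure U = lebesgue_measure (U `\` A) + lebesgue_measure (U `&` A))%E.
  exact: measureDI.
have -> : lebesgue_measure (U `&` A) = 0%E; last by rewrite adde0.
apply/eqP; rewrite eq_le measure_ge0 andbT -A0 le_measure ?inE//.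
exact: measurableI.
Qed.

Lemma sum_disjoint_itv_le (U : set R) n (l r : 'I_n -> R) : measurable U ->
  (forall i, l i <= r i) -> (forall i, `]l i, r i[ `<=` U) ->
  trivIset [set: 'I_n] (fun i => `]l i, r i[%classic) ->
  ((\sum_i (r i - l i))%:E <= lebesgue_measure U)%E.
Proof.
move=> mU lr lrU tlr.
have mI : measurable (\big[setU/set0]_(i < n) (`]l i, r i[%classic : set R)).
  by apply: bigsetU_measurable.
apply: (@le_trans _ _ (lebesgue_measure (\big[setU/set0]_(i < n) (`]l i, r i[%classic : set R)))).
  rewrite measure_semi_additive_ord// -sumEFin; apply: lee_sum => i _ /=.
  rewrite lebesgue_measure_itv/= lte_fin; case: ltP => [_|rl]; first by rewrite EFinB.
  by rewrite lee_fin subr_le0.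
rewrite le_measure ?inE//.
by apply: (big_ind (fun S : set R => S `<=` U)) => // S S' SU SU'; rewrite subUset.
Qed.

(* A gauge argument: away from the null set where [g] is not differentiable,
   increments are at most [e * length]; the intervals tagged in the null set
   lie in an open set of small measure, where absolute continuity applies. *)
Lemma abs_continuous_is_derive0 T (g : R -> R) : 0 <= T ->
  abs_continuous (V := R^o) 0 T g ->
  {ae @lebesgue_measure R, forall t : R, 0 <= t ->
    is_derive (t : R^o) 1 (g : R^o -> R^o) 0} ->
  g T = g 0.
Proof.
move=> T0 acg g0; apply/eqP; rewrite -subr_eq0 -normr_le0; apply/ler_addgt0Pr => e e0.
(* Of the total error, [e' * T] pays for the tags with zero derivative and one further [e'] for the
   intervals inside [U]. *)
have e1 : 0 < e / (T + 1) by rewrite divr_gt0//; lra.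
set e' := e / _ in e1; rewrite add0r.
have [d d0 gd] := acg _ e1.
have [U [oU UN Ud]] := negligible_open_cover g0 d0.
have mU : measurable U by exact: open_measurable.
(* The list [s] collects, from left to right, the intervals met so far whose tags are exceptional;
   all others are charged to [e' * x]. *)
pose P x := exists s : seq (R * R), [/\ all (fun p => (0 <= p.1 <= p.2) && (p.2 <= x)) s,
  pairwise (fun p q => p.2 <= q.1) s, (forall p, p \in s -> `]p.1, p.2[ `<=` U) &
  `|g x - g 0| <= e' * x + \sum_(p <- s) `|g p.2 - g p.1| ].
suff [s [/allP sT ps sU gs]] : P T.
  have -> : e = e' * T + e' by rewrite /e'; field; rewrite lt0r_neq0//; lra.
  apply: (le_trans gs); rewrite lerD2l ltW//.
  pose l (i : 'I_(size s)) := (nth (0, 0) s i).1.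
  pose r (i : 'I_(size s)) := (nth (0, 0) s i).2.
  rewrite (big_nth (0, 0)) big_mkord.
  have lr i : 0 <= l i /\ l i <= r i /\ r i <= T.
    by have /sT/andP[/andP[]] := mem_nth (0, 0) (ltn_ord i).
  have tlr : trivIset [set: 'I_(size s)] (fun i => `]l i, r i[%classic).
    have disj (i j : 'I_(size s)) : (i < j)%N -> r i <= l j.
      by move=> ij; apply: (pairwiseP (0, 0) ps); rewrite ?inE.
    move=> i j _ _ [t []] /=; rewrite !in_itv/= => /andP[li ri] /andP[lj rj].
    apply: val_inj; case: (ltngtP i j) => // /disj ?; exfalso; lra.
  apply: gd => //.
  rewrite -lte_fin; apply: le_lt_trans Ud; apply: sum_disjoint_itv_le => // i.
    by have [_ []] := lr i.
  by apply: sU; exact: mem_nth.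
apply: real_induction => //.
  by exists [::]; split=> //; rewrite subrr normr0 big_nil mulr0 addr0.
move=> x /andP[x0 xT].
have [|/UN Ux] := pselect (0 <= x -> is_derive (x : R^o) 1 (g : R^o -> R^o) 0).
  move=> /(_ x0) gx; have [b b0 gb] := is_derive0_near gx e1.
  exists b => // y z /andP[y0 yx] /andP[xz zT] xy zx [s [/allP sy ps sU gs]].
  exists s; split=> //.
    by apply/allP => p /sy/andP[-> /le_trans]; apply; exact: le_trans xz.
  have gzx : `|g z - g x| <= e' * (z - x).
    by rewrite (le_trans (gb _ _))// ger0_norm//; lra.
  have gyx : `|g y - g x| <= e' * (x - y).
    by rewrite (le_trans (gb _ _))// distrC ger0_norm//; lra.
  have -> : g z - g 0 = (g z - g x) - (g y - g x) + (g y - g 0) by ring.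
  rewrite (le_trans (ler_normD _ _))//.
  by have := ler_normB (g z - g x) (g y - g x); lra.
have /nbhs_ballP[b /= b0 xbU] := open_nbhs_nbhs (conj oU Ux).
exists b => // y z /andP[y0 yx] /andP[xz zT] xy zx [s [/allP sy ps sU gs]].
exists (rcons s (y, z)); split=> //.
- rewrite all_rcons /= y0 (le_trans yx xz) lexx/=.
  apply/allP => p /sy/andP[-> /le_trans]; apply; exact: le_trans xz.
- rewrite pairwise_rcons ps andbT; apply/allP => p /sy /=.
  by case/andP.
- move=> p; rewrite mem_rcons inE => /predU1P[->/=|/sU//].
  move=> t /=; rewrite in_itv/= => /andP[yt tz]; apply: xbU.
  by rewrite /ball/= ltr_norml; apply/andP; split; lra.
- rewrite -cats1 big_cat big_seq1/=.
  have -> : g z - g 0 = (g y - g 0) + (g z - g y) by ring.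
  have yz : e' * y <= e' * z by rewrite ler_wpM2l ?(ltW e1)//; lra.
  by have := ler_normD (g y - g 0) (g z - g y); lra.
Qed.

End AbsolutelyContinuous.

(** * Trajectories of the control system *)

Section Solutions.
Variable R : realType.
Implicit Types (w v : nat -> R) (x y s t T c : R).

#[local] Instance ae_lebesgue_filter : Filter (almost_everywhere (@lebesgue_measure R)).
Proof. exact: (@ae_filter_ringOfSetsType _ _ _ (@lebesgue_measure R)). Qed.

Lemma is_derive_mxP (V : normedModType R) m n (M : V -> 'M[R]_(m, n)) (t v : V)
    (dM : 'M[R]_(m, n)) :
  is_derive t v M dM <->
  forall i j, is_derive t v (fun z => M z i j : R^o) (dM i j).
Proof.
split=> [[DM <-] i j|DM].
  split; first by move/derivable_mxP : DM; exact.
  by rewrite derive_mx// mxE.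
have dM' : derivable M t v by apply/derivable_mxP => i j; case: (DM i j).
split=> //; rewrite derive_mx//; apply/matrixP => i j; rewrite mxE.
by case: (DM i j).
Qed.

Lemma norm_coord_le n (M : 'rV[R]_n.+1) i : `|M 0 i| <= `|M|.
Proof.
rewrite [leRHS]/Num.Def.normr/= mx_normrE.
exact: (le_bigmax _ (fun k : 'I_1 * 'I_n.+1 => `|M k.1 k.2|) (0, i)).
Qed.

Lemma norm_rV_le n (M : 'rV[R]_n.+1) : `|M| <= \sum_i `|M 0 i|.
Proof.
rewrite [leLHS]/Num.Def.normr/= mx_normrE; apply: bigmax_le.
  by apply: sumr_ge0.
move=> [i j] _ /=; rewrite ord1 (bigD1 j)//= lerDl.
exact: sumr_ge0.
Qed.

Lemma abs_continuous_rV n a b (phi : R -> 'rV[R]_n.+1) :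
  abs_continuous a b phi <->
  forall i, abs_continuous (V := R^o) a b (fun t => phi t 0 i).
Proof.
split=> [acp i e e0|acp e e0].
  have [d d0 pd] := acp e e0; exists d => // k l r lr tlr lrd.
  apply: le_lt_trans (pd _ _ _ lr tlr lrd); apply: ler_sum => j _.
  by rewrite (le_trans _ (norm_coord_le _ i))// !mxE.
have en : 0 < e / n.+1%:R by rewrite divr_gt0.
have /choice[d dP] : forall i, exists d : R, 0 < d /\
    forall (k : nat) (l r : 'I_k -> R),
      (forall i, a <= l i /\ l i <= r i /\ r i <= b) ->
      trivIset [set: 'I_k] (fun i => `]l i, r i[%classic) ->
      \sum_i (r i - l i) < d ->
      \sum_j `|phi (r j) 0 i - phi (l j) 0 i| < e / n.+1%:R.
  by move=> i; have [d] := acp i _ en; exists d.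
exists (\big[Num.min/1]_i d i).
  by apply: lt_bigmin => // i _; case: (dP i).
move=> k l r lr tlr lrd.
apply: (@le_lt_trans _ _ (\sum_(i < n.+1) \sum_j `|phi (r j) 0 i - phi (l j) 0 i|)).
  rewrite exchange_big/=; apply: ler_sum => j _.
  apply: le_trans (norm_rV_le _) _; apply: ler_sum => i _; by rewrite !mxE.
have -> : e = \sum_(i < n.+1) e / n.+1%:R.
  by rewrite sumr_const card_ord -[RHS]mulr_natr divfK.
apply: ltr_sum; first by apply/hasP; exists 0; rewrite ?mem_index_enum.
move=> i _; have [_ ] := dP i; apply=> //.
by apply: lt_le_trans lrd _; exact: bigmin_le.
Qed.

Lemma abs_continuous_expR T : abs_continuous (V := R^o) 0 T (@expR R).
Proof.
apply: (@abs_continuous_lipschitz _ R^o _ _ _ (expR T)) => x y /andP[x0 xy] yT.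
have -> : expR y - expR x = expR y * (1 - expR (x - y)).
  by rewrite mulrBr mulr1 -expRD (addrC y) subrK.
rewrite normrM ger0_norm ?expR_ge0// ler_pM ?expR_ge0 ?normr_ge0//.
  by rewrite ler_expR.
rewrite ger0_norm; last by rewrite subr_ge0 -expR0 ler_expR; lra.
by have := expR_ge1Dx (x - y); lra.
Qed.

(** The integrating factor [expR t] turns the equation into a vanishing derivative. It applies to
    the z-coordinate and to the difference of two y-coordinates. *)
Lemma abs_continuous_decay T (h : R -> R) : 0 <= T ->
  abs_continuous (V := R^o) 0 T h ->
  {ae @lebesgue_measure R, forall t : R, 0 <= t ->
    is_derive (t : R^o) 1 (h : R^o -> R^o) (- h t)} ->
  h T = h 0 * expR (- T).
Proof.
move=> T0 ach dh.
have : expR T * h T = expR 0 * h 0.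
  apply: (@abs_continuous_is_derive0 _ T (fun t => expR t * h t)) => //.
    by apply: abs_continuousM => //; exact: abs_continuous_expR.
  move: dh; apply: filterS => t ht /ht{}ht.
  apply: (is_derive_eq (is_deriveM (is_derive_expR t) ht)).
  by rewrite /GRing.scale/=; ring.
rewrite expR0 mul1r => <-.
by rewrite mulrAC -expRD subrr expR0 mul1r.
Qed.

Lemma abs_continuousB a b (f g : R -> R) :
  abs_continuous (V := R^o) a b f -> abs_continuous (V := R^o) a b g ->
  abs_continuous (V := R^o) a b (fun t => f t - g t).
Proof.
move=> acf acg e e0; have e1 : 0 < e / 2 by rewrite divr_gt0.
have [df df0 fd] := acf _ e1; have [dg dg0 gd] := acg _ e1.
exists (Num.min df dg); first by rewrite lt_min df0.
move=> n l r lr tlr; rewrite lt_min => /andP[lrf lrg].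
have {}fd := fd _ _ _ lr tlr lrf; have {}gd := gd _ _ _ lr tlr lrg.
apply: (@le_lt_trans _ _ (\sum_i `|f (r i) - f (l i)| + \sum_i `|g (r i) - g (l i)|)).
  rewrite -big_split/=; apply: ler_sum => i _.
  have -> : f (r i) - g (r i) - (f (l i) - g (l i)) =
    (f (r i) - f (l i)) - (g (r i) - g (l i)) by ring.
  exact: ler_normB.
by rewrite (splitr e) ltrD.
Qed.

Lemma vec3E (z c y : R) : [/\ vec3 z c y 0 0 = z, vec3 z c y 0 1 = c & vec3 z c y 0 2 = y].
Proof. by split; rewrite mxE. Qed.

Lemma solution_coord (x : 'rV[R]_3) u (phi : R -> 'rV[R]_3) T :
  solution (@ex_rhs R) x u phi -> 0 <= T ->
  forall i, abs_continuous (V := R^o) 0 T (fun t => phi t 0 i).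
Proof.
(* A solution is absolutely continuous on positive horizons only; passing to [T + 1] includes
   [T = 0]. *)
move=> [_ acp _] T0 i; have T1 : 0 < T + 1 by lra.
move=> e e0; have [d d0 pd] := (abs_continuous_rV _ _ _).1 (acp _ T1) i e e0.
by exists d => // n l r lr; apply: pd => j; have [? [? ?]] := lr j; do !split => //; lra.
Qed.

Lemma solution_zc c u phi t : solution (@ex_rhs R) (vec3 1 c 0) u phi -> 0 <= t ->
  phi t 0 0 = expR (- t) /\ phi t 0 1 = c.
Proof.
move=> sphi t0; have ac := solution_coord sphi t0.
have [phi0 _ dphi] := sphi; have [z0 c0 _] := vec3E 1 c 0; split.
  rewrite (abs_continuous_decay t0 (ac 0)) /= ?phi0 ?z0 ?mul1r//.
  move: dphi; apply: filterS => s ds /ds/is_derive_mxP/(_ 0 0).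
  by rewrite /ex_rhs; have [-> _ _] := vec3E (- phi s 0 0) 0 (- phi s 0 2 + phi s 0 0 * u s).
rewrite (abs_continuous_is_derive0 t0 (ac 1)) /= ?phi0//.
move: dphi; apply: filterS => s ds /ds/is_derive_mxP/(_ 0 1).
by rewrite /ex_rhs; have [_ -> _] := vec3E (- phi s 0 0) 0 (- phi s 0 2 + phi s 0 0 * u s).
Qed.

(** Both z-coordinates are [expR (- t)], so the forcing terms z u cancel almost everywhere and the
    difference decays from 0. One control class thus produces a single y-curve, whatever the
    starting points [c] and [c']. *)
Lemma solution_y c c' u u' phi phi' t :
  solution (@ex_rhs R) (vec3 1 c 0) u phi -> solution (@ex_rhs R) (vec3 1 c' 0) u' phi' ->
  ae_eq (@lebesgue_measure R) `[0, +oo[%classic u u' -> 0 <= t ->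
  phi t 0 2 = phi' t 0 2.
Proof.
move=> sphi sphi' uu' t0; apply/eqP; rewrite -subr_eq0.
have ac := abs_continuousB (solution_coord sphi t0 2) (solution_coord sphi' t0 2).
have [phi0 _ dphi] := sphi; have [phi0' _ dphi'] := sphi'.
rewrite (abs_continuous_decay t0 ac) /= ?phi0 ?phi0'.
  by have [_ _ ->] := vec3E 1 c 0; have [_ _ ->] := vec3E 1 c' 0; rewrite subrr mul0r.
move: dphi dphi' uu'; apply: filterS3 => s ds ds' us s0.
have /is_derive_mxP/(_ 0 2) d2 := ds s0; have /is_derive_mxP/(_ 0 2) d2' := ds' s0.
apply: (is_derive_eq (is_deriveB d2 d2')); rewrite /ex_rhs.
have [_ _ ->] := vec3E (- phi s 0 0) 0 (- phi s 0 2 + phi s 0 0 * u s).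
have [_ _ ->] := vec3E (- phi' s 0 0) 0 (- phi' s 0 2 + phi' s 0 0 * u' s).
have [-> _] := solution_zc sphi s0; have [-> _] := solution_zc sphi' s0.
rewrite us; first by ring.
by rewrite /= in_itv/= s0.
Qed.

(** The walk without a fixed horizon: at time t the letters after index [truncn t] have zero
    ramps. *)
Definition walk_at w t : R := walk w (Num.truncn t).+1 t.

Lemma walk_atE w n t : t <= n%:R -> walk_at w t = walk w n t.
Proof.
move=> tn; rewrite /walk_at; case: (leqP (Num.truncn t).+1 n) => [le|/ltnW le].
  by rewrite (@walk_stable _ w t (Num.truncn t).+1 n)// ltW// truncnS_gt.
by rewrite (@walk_stable _ w t n (Num.truncn t).+1).
Qed.

Lemma match_q_walk_at c t : cantor_set R c -> 0 <= t -> match_q t c = walk_at (sigma c) t.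
Proof.
move=> Cc t0; rewrite (@match_qE _ _ (Num.truncn t).+1)// t0/=.
by rewrite ltW// truncnS_gt.
Qed.

Lemma match_F_expR c t : cantor_set R c -> 0 <= t ->
  match_F (expR (- t)) c = expR (- t) * walk_at (sigma c) t.
Proof. by move=> Cc t0; rewrite /match_F expR_gt0 expRK opprK match_q_walk_at. Qed.

Lemma is_derive_walk_at w t : 0 <= t -> (forall n : nat, t != n%:R) ->
  is_derive (t : R^o) 1 (walk_at w : R^o -> R^o) (step w t).
Proof.
move=> t0 tn; have /andP[nt tn1] := truncn_itv t0; set n := Num.truncn t in nt tn1.
have {}nt : n%:R < t by rewrite lt_neqAle eq_sym tn.
apply: (@near_eq_is_derive _ _ _ (fun s : R^o => (\sum_(j < n) w j + w n * (s - n%:R) : R^o))).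
  near=> s; rewrite (@walk_atE w n.+1); last by apply: ltW; near: s; exact: lt_nbhsl.
  rewrite walk_itv//; apply/andP; split; apply: ltW; near: s.
    exact: lt_nbhsr.
  exact: lt_nbhsl.
rewrite /step -/n.
apply: is_derive_eq.
by rewrite /GRing.scale/=; ring.
Unshelve. all: by end_near. Qed.

(** [w] and [c] are independent because the control comes from a finite word while the starting
    point has its own letters. *)
Definition traj w c t : 'rV[R]_3 := vec3 (expR (- t)) c (expR (- t) * walk_at w t).

(** Integer times are where a letter may change and [walk_at] may have a corner. *)
Lemma ae_not_nat : {ae @lebesgue_measure R, forall t, forall n : nat, t != n%:R}.
Proof.
pose N := \bigcup_n [set n%:R : R].
exists N; split.
- by apply: bigcup_measurable => n _; exact: measurable_set1.
- apply: countable_lebesgue_measure0; apply: bigcup_countable => [|n _]; first exact: countableP.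
  exact: countable1.
- move=> t /= /existsNP[n /negP/negPn/eqP ->]; by exists n.
Qed.

Lemma abs_continuous_expRN T : abs_continuous (V := R^o) 0 T (fun t => expR (- t) : R).
Proof.
apply: (@abs_continuous_lipschitz _ R^o _ _ _ 1) => x y /andP[x0 xy] yT.
have -> : expR (- y) - expR (- x) = - (expR (- x) * (1 - expR (x - y))).
  by rewrite mulrBr mulr1 -expRD addKr opprB.
rewrite normrN normrM ger0_norm ?expR_ge0// ler_pM ?expR_ge0 ?normr_ge0//.
  by rewrite -expR0 ler_expR; lra.
rewrite ger0_norm; last by rewrite subr_ge0 -expR0 ler_expR; lra.
by have := expR_ge1Dx (x - y); lra.
Qed.

Lemma abs_continuous_walk_at w T : Sigma w -> abs_continuous (V := R^o) 0 T (walk_at w).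
Proof.
move=> Sw; pose n := (Num.truncn T).+1.
apply: (@abs_continuous_lipschitz _ R^o _ _ _ n%:R) => x y /andP[x0 xy] yT.
have yn : y <= n%:R by rewrite (le_trans yT)// ltW// truncnS_gt.
rewrite !(@walk_atE w n)//; last exact: le_trans yn.
by rewrite (le_trans (walk_lipschitz _ _ _ Sw))// ger0_norm ?subr_ge0.
Qed.

Lemma solution_traj w c : Sigma w ->
  solution (@ex_rhs R) (vec3 1 c 0) (step w) (traj w c).
Proof.
move=> Sw; split.
- by rewrite /traj oppr0 expR0 mul1r /walk_at walk0.
- move=> T T0; apply/abs_continuous_rV; case=> -[|[|[|//]]] i3.
  + rewrite (_ : (fun t => _) = fun t => expR (- t)); last by apply/funext => t; rewrite mxE.
    exact: abs_continuous_expRN.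
  + apply: (@abs_continuous_lipschitz _ R^o _ _ _ 0) => x y _ _.
    by rewrite !mxE/= subrr normr0 mul0r.
  + rewrite (_ : (fun t => _) = fun t => expR (- t) * walk_at w t); last first.
      by apply/funext => t; rewrite mxE.
    apply: abs_continuousM; [exact: ltW|exact: abs_continuous_expRN|].
    exact: abs_continuous_walk_at.
- apply: filterS ae_not_nat => t tn t0; apply/is_derive_mxP => i j.
  have dz : is_derive (t : R^o) 1 (fun s : R^o => expR (- s) : R^o) (- expR (- t)).
    apply: (is_derive_eq (is_derive1_comp (is_derive_expR (- t)) (is_deriveN (is_derive_id t 1)))).
    by rewrite mulrN1.
  have dq := is_derive_walk_at w t0 tn.
  have [z0 c0 y0] := vec3E (expR (- t)) c (expR (- t) * walk_at w t).
  rewrite /ex_rhs z0 y0 {i}ord1 {z0 c0 y0}.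
  case: j => -[|[|[|//]]] i3; rewrite mxE/=.
  + rewrite (_ : (fun s => _) = fun s => expR (- s))//; last first.
      by apply/funext => s; rewrite mxE.
  + rewrite (_ : (fun s => _) = cst c); last by apply/funext => s; rewrite mxE.
    exact: is_derive_cst.
  + rewrite (_ : (fun s => _) = (fun s : R^o => expR (- s)) * walk_at w); last first.
      by apply/funext => s; rewrite mxE.
    apply: (is_derive_eq (is_deriveM dz dq)).
    by rewrite /GRing.scale/=; ring.
Qed.

(** Up to time n only the first n letters have acted, so the curve driven by [w] runs in the graph
    of F over the point coded by [v]. *)
Lemma traj_in_Q w v t (n : nat) : Sigma w -> Sigma v -> 0 <= t <= n%:R ->
  (forall j, (j < n)%N -> w j = v j) -> ex_Q R (traj w (coding v) t).
Proof.
move=> Sw Sv /andP[t0 tn] wv.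
have Cv : cantor_set R (coding v) by exists v.
exists (expR (- t), coding v) => /=.
  by split=> //=; rewrite in_itv/= expR_ge0/= -expR0 ler_expR; lra.
rewrite match_F_expR// sigmaK// /traj !(@walk_atE _ n)//.
by rewrite (eq_walk _ wv).
Qed.

End Solutions.

(** * Counting through injections and parametrizations *)

Section Cardinality.
Variables (T : finType) (U : Type) (S : set U) (m : nat) (f : T -> U).

Lemma card_eq_II_ge : injective f -> (forall x, S (f x)) -> (S #= `I_m)%card -> (#|T| <= m)%N.
Proof.
move=> finj Sf; rewrite card_eq_le => /andP[/card_leP[h] _].
pose k x : 'I_m := Ordinal (set_valP (h (SigSub (mem_set (Sf x))))).
rewrite -[leqRHS]card_ord; apply: (@leq_card _ _ k) => x y /(congr1 val)/= hxy.
apply: finj; suff /(congr1 val) : SigSub (mem_set (Sf x)) = SigSub (mem_set (Sf y)) by [].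
by apply: (@inj _ _ _ h); rewrite ?inE//; apply: val_inj.
Qed.

Lemma card_eq_II_le : S `<=` range f -> (S #= `I_m)%card -> (m <= #|T|)%N.
Proof.
move=> Sf; rewrite card_eq_le => /andP[_ /card_leP[h]].
pose i' (i : 'I_m) : set_type `I_m := SigSub (mem_set (ltn_ord i : `I_m i)).
have /choice[k kP] (i : 'I_m) : exists x, f x = val (h (i' i)).
  by have [x _ fx] := Sf _ (set_valP (h (i' i))); exists x.
rewrite -[leqLHS]card_ord; apply: (@leq_card _ _ k) => i j kij; apply: val_inj.
suff /(congr1 val) : i' i = i' j by [].
by apply: (@inj _ _ _ h); rewrite ?inE//; apply: val_inj; rewrite -!kP kij.
Qed.

End Cardinality.

(** * Spanning sets and the two entropies *)

Section Entropy.
Variable R : realType.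
Implicit Types (w v : nat -> R) (x y s t T c : R) (D : set R).

(** The default [true] continues a word by 1s, in agreement with [truncate] and with the points of
    C_n. *)
Definition word n (b : n.-tuple bool) : nat -> R :=
  fun j => if nth true b j then 1 else -1.

Lemma Sigma_word n (b : n.-tuple bool) : Sigma (word b).
Proof. by move=> j; rewrite /word; case: ifP => _; [right|left]. Qed.

Lemma word_truncate n w : Sigma w -> exists b : n.-tuple bool, word b = truncate n w.
Proof.
move=> Sw; exists [tuple w i == 1 | i < n]; apply/funext => j.
rewrite /word /truncate; case: ltnP => jn; last by rewrite nth_default ?size_tuple.
rewrite -(tnth_nth _ _ (Ordinal jn)) tnth_mktuple /=.
by case: (Sw j) => ->; case: eqP => // ?; exfalso; lra.
Qed.

Lemma word_inj n (b b' : n.-tuple bool) :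
  (forall j, (j < n)%N -> word b j = word b' j) -> b = b'.
Proof.
move=> bb'; apply/val_inj/(@eq_from_nth _ true); first by rewrite !size_tuple.
move=> j; rewrite size_tuple => /bb'; rewrite /word.
by case: (nth _ b j); case: (nth _ b' j) => //; lra.
Qed.

Definition word_controls n : set (set (R -> R)) :=
  range (fun b : n.-tuple bool => control_class (@ex_U R) (step (word b))).

(** The word length [n] counts controls, while [N] counts the letters that matter up to time T. For
    K both grow with T; for K_n the first stays fixed. *)
Lemma spanning_word_controls n N T D : D `<=` cantor_set R -> T <= N%:R ->
  (forall c, D c -> exists b : n.-tuple bool, forall j, (j < N)%N -> word b j = sigma c j) ->
  spanning (@ex_rhs R) (@ex_U R) T [set vec3 1 c 0 | c in D] (ex_Q R) (word_controls n).
Proof.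
move=> DC TN Db; split.
- exact: finite_image.
- move=> _ [b _ <-]; exists (step (word b)) => //.
  by apply: admissible_step; exact: Sigma_word.
- move=> _ [c Dc <-]; have [b bc] := Db c Dc.
  exists (control_class (@ex_U R) (step (word b))); first by exists b.
  have [Sc cE] := cantorP (DC _ Dc).
  exists (step (word b)), (traj (word b) c); split.
  + split; last exact: ae_eq_refl.
    by apply: admissible_step; exact: Sigma_word.
  + by apply: solution_traj; exact: Sigma_word.
  + move=> t /andP[t0 tT]; rewrite -cE; apply: (@traj_in_Q _ _ _ _ N) => //.
      exact: Sigma_word.
    by rewrite t0 (le_trans tT).
Qed.

Lemma r_inv_le n N T D : D `<=` cantor_set R -> T <= N%:R ->
  (forall c, D c -> exists b : n.-tuple bool, forall j, (j < N)%N -> word b j = sigma c j) ->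
  (r_inv (@ex_rhs R) (@ex_U R) T [set vec3 1 c 0 | c in D] (ex_Q R) <= (2 ^+ n)%:E)%E.
Proof.
move=> DC TN Db; have sp := spanning_word_controls DC TN Db.
have [/finite_setP[m mS] _ _] := sp.
apply: (@le_trans _ _ (m%:R)%:E).
  by apply: ereal_inf_lbound; exists m => //; exists (word_controls n).
rewrite lee_fin -natrX ler_nat.
have := @card_eq_II_le (n.-tuple bool) _ _ _ _ (@subset_refl _ _) mS.
by rewrite card_tuple card_bool.
Qed.

(** A nonempty initial set excludes the empty spanning set, whose logarithm would be minus
    infinity. *)
Lemma r_inv_ge1 T D : D !=set0 ->
  (1 <= r_inv (@ex_rhs R) (@ex_U R) T [set vec3 1 c 0 | c in D] (ex_Q R))%E.
Proof.
move=> [c Dc]; apply: le_ereal_inf_tmp => _ [m [S [_ _ spS] Sm] <-].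
have [u Su _] := spS _ (ex_intro2 _ _ c Dc erefl).
rewrite lee_fin ler1n; have := @card_eq_II_ge unit _ S m (fun=> u) _ _ Sm.
by rewrite card_unit; apply=> // -[] [].
Qed.

Lemma ex_Q_y (x : 'rV[R]_3) : ex_Q R x -> x 0 2 = match_F (x 0 0) (x 0 1).
Proof. by move=> [p _ <-]; have [-> -> ->] := vec3E p.1 p.2 (match_F p.1 p.2). Qed.

(** Choosing a control class for each point coded by a word of length n is injective: a shared class
    forces equal y-coordinates, hence equal walks at the integer times up to n, hence equal
    letters. *)
Lemma r_inv_K_ge n T : n%:R <= T ->
  ((2 ^+ n)%:E <= r_inv (@ex_rhs R) (@ex_U R) T (ex_K R) (ex_Q R))%E.
Proof.
move=> nT; apply: le_ereal_inf_tmp => _ [m [S [_ Sc spS] Sm] <-].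
rewrite lee_fin -natrX ler_nat.
have Cb (b : n.-tuple bool) : cantor_set R (coding (word b)).
  by exists (word b) => //; exact: Sigma_word.
have /choice[f fP] (b : n.-tuple bool) : exists w : set (R -> R), S w /\
    exists u phi, [/\ w u, solution (@ex_rhs R) (vec3 1 (coding (word b)) 0) u phi &
      forall t, 0 <= t <= T -> ex_Q R (phi t)].
  by have [w Sw wP] := spS _ (ex_intro2 _ _ _ (Cb b) erefl); exists w.
have := @card_eq_II_ge _ _ S m f _ _ Sm; rewrite card_tuple card_bool; apply; last first.
  by move=> b; have [] := fP b.
move=> b b' fbb'; apply: word_inj; apply: eq_walk_word => k kn.
have [Sb [u [phi [wu sphi Qphi]]]] := fP b.
have [_ [u' [phi' [wu' sphi' Qphi']]]] := fP b'.
have kT : 0 <= (k%:R : R) <= T.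
  by rewrite ler0n (le_trans _ nT)// ler_nat.
have k0 : 0 <= k%:R :> R by [].
(* Both controls represent the same class, so they agree only almost everywhere. *)
have uu' : ae_eq (@lebesgue_measure R) `[0, +oo[%classic u u'.
  have [u0 _ fu0] := Sc _ Sb; rewrite -fbb' -fu0 in wu'; rewrite -fu0 in wu.
  by apply: ae_eq_trans wu'.2; apply: ae_eq_sym; exact: wu.2.
have := solution_y sphi sphi' uu' k0.
rewrite (ex_Q_y (Qphi _ kT)) (ex_Q_y (Qphi' _ kT)).
have [-> ->] := solution_zc sphi k0; have [-> ->] := solution_zc sphi' k0.
rewrite !match_F_expR// !sigmaK; [|exact: Sigma_word..].
by rewrite !(@walk_atE _ _ k)// => /mulfI; apply; rewrite gt_eqF ?expR_gt0.
Qed.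

(** Taking logarithms and dividing by T leaves an error [b / T]. The constant [b] absorbs the
    rounding of T for K, and the whole fixed count of controls for K_n. *)
Lemma limf_esup_log_growth (r : R -> \bar R) (l b : R) : 0 <= b ->
  (forall T, 1 <= T ->
    ((expR (l * T - b))%:E <= r T)%E /\ (r T <= (expR (l * T + b))%:E)%E) ->
  limf_esup (fun T : R => ((T^-1)%:E * lne (r T))%E) (+oo)%R = l%:E.
Proof.
move=> b0 rb; pose f T : \bar R := ((T^-1)%:E * lne (r T))%E.
have fE T : 1 <= T -> exists y : R, f T = y%:E /\ l - b / T <= y <= l + b / T.
  move=> T1; have T0 : 0 < T by lra.
  have [] := rb T T1; rewrite /f; case: (r T) => [x| |]//; rewrite !lee_fin => xl xu.
  have x0 : 0 < x by rewrite (lt_le_trans _ xl)// expR_gt0.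
  exists (T^-1 * ln x); rewrite lne_EFin//; split=> //.
  have -> : l - b / T = (l * T - b) / T by field; rewrite lt0r_neq0.
  have -> : l + b / T = (l * T + b) / T by field; rewrite lt0r_neq0.
  rewrite [T^-1 * _]mulrC.
  rewrite !ler_pM2r ?invr_gt0//; apply/andP; split.
    by rewrite -ler_expR lnK.
  by rewrite -ler_expR lnK.
(* Beyond [b / e] the error is at most [e]; the 1 keeps T in the range where the sandwich is
   assumed. *)
have bT e T : 0 < e -> Num.max 1 (b / e) <= T -> 1 <= T /\ b / T <= e.
  move=> e0; rewrite ge_max => /andP[T1]; rewrite ler_pdivrMr// => bTe; split=> //.
  by rewrite ler_pdivrMr ?(lt_le_trans ltr01)// mulrC.
apply/eqP; rewrite eq_le; apply/andP; split.
  apply/lee_addgt0Pr => e e0.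
  apply: (@le_trans _ _ (ereal_sup (f @` [set T | Num.max 1 (b / e) <= T]))).
    apply: ereal_inf_lbound; exists [set T | Num.max 1 (b / e) <= T] => //.
    by apply: nbhs_pinfty_ge; exact: num_real.
  apply: ge_ereal_sup => _ [T /= /(bT _ _ e0)[T1 bTe] <-].
  have [y [-> /andP[_ yl]]] := fE T T1.
  by rewrite -EFinD lee_fin (le_trans yl)// lerD2l.
apply: le_ereal_inf_tmp => _ [V Voo <-]; apply/lee_addgt0Pr => e e0.
have [T [VT /(bT _ _ e0)[T1 bTe]]] : exists T, V T /\ Num.max 1 (b / e) <= T.
  have [M [_ MV]] : +oo%R V by exact: Voo.
  exists (Num.max (M + 1) (Num.max 1 (b / e))); split; last by rewrite le_max lexx orbT.
  by apply: MV; rewrite lt_max ltrDl ltr01.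
have [y [fT /andP[yl _]]] := fE T T1.
rewrite -leeBlDr//; apply: (@le_trans _ _ (f T)); last by apply: ereal_sup_ubound; exists T.
by rewrite fT -EFinB lee_fin (le_trans _ yl)// lerD2l lerN2.
Qed.

Lemma expR_ln2 (n : nat) : expR (n%:R * ln 2) = 2 ^+ n :> R.
Proof. by rewrite mulrC expRM_natr lnK// posrE. Qed.

Lemma h_inv_K : ex_h (ex_K R) (ex_Q R) = (ln 2)%:E.
Proof.
have l20 : 0 <= ln 2 :> R by rewrite ln_ge0// ler1n.
(* Here [b = ln 2], the price of one letter: the word lengths [n] and [n.+1] are within 1 of T. *)
apply: (limf_esup_log_growth l20) => T T1.
have /andP[nT Tn] := truncn_itv (le_trans ler01 T1).
set n := Num.truncn T in nT Tn; split.
  apply: (@le_trans _ _ (2 ^+ n)%:E); last exact: r_inv_K_ge.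
  rewrite lee_fin -expR_ln2 ler_expR -[X in _ - X]mul1r mulrC -mulrBl ler_wpM2r//.
  by rewrite lerBlDr natr1 ltW.
apply: (@le_trans _ _ (2 ^+ n.+1)%:E).
  apply: (@r_inv_le n.+1 n.+1) => //; first exact: ltW.
  move=> c /cantorP[Sc _]; have [b bc] := word_truncate n.+1 Sc.
  by exists b => j jn; rewrite bc /truncate jn.
rewrite lee_fin -expR_ln2 ler_expR -[X in _ + X]mul1r [ln 2 * _]mulrC -mulrDl ler_wpM2r//.
by rewrite -natr1 lerD2r.
Qed.

Lemma h_inv_Kn n : ex_h (ex_Kn R n) (ex_Q R) = 0%E.
Proof.
have nl20 : 0 <= n%:R * ln 2 :> R by rewrite mulr_ge0// ln_ge0// ler1n.
(* Growth rate 0 with [b = n * ln 2], since the bound 2^n is independent of T. *)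
apply: (limf_esup_log_growth nl20) => T T1; rewrite mul0r sub0r add0r; split.
  apply: (@le_trans _ _ 1%E).
    by rewrite lee_fin -[leRHS]expR0 ler_expR oppr_le0.
  apply: r_inv_ge1; rewrite cantor_approxE.
  by exists (coding (truncate n (fun=> 1))), (fun=> 1) => // j; right.
rewrite expR_ln2; apply: (@r_inv_le n (Num.truncn T).+1).
- exact: cantor_approx_sub.
- by rewrite ltW// truncnS_gt.
- rewrite cantor_approxE => _ [w Sw <-]; have [b bw] := word_truncate n Sw.
  by exists b => j _; rewrite bw sigmaK//; exact: Sigma_truncate.
Qed.

End Entropy.

(** * Compactness of Q, K and K_n *)

Section Compactness.
Variable R : realType.
Implicit Types (w v : nat -> R) (x y z s t T c : R).

(** Parametrizes [Sigma] by the compact space of boolean sequences, so that compactness passes to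
    continuous images. *)
Definition signs (a : cantor_space) : nat -> R := fun j => if a j then 1 else -1.

Lemma Sigma_signs a : Sigma (signs a).
Proof. by move=> j; rewrite /signs; case: ifP => _; [right|left]. Qed.

Lemma range_signs : range signs = @Sigma R.
Proof.
apply/seteqP; split=> [_ [a _ <-]|w Sw]; first exact: Sigma_signs.
exists (fun j => w j == 1) => //; apply/funext => j; rewrite /signs.
by case: (Sw j) => ->; case: eqP => // ?; exfalso; lra.
Qed.

Lemma near_signs (a : cantor_space) n :
  \forall b \near a, forall j, (j < n)%N -> signs b j = signs a j.
Proof.
have Fa : Filter (nbhs a) := nbhs_filter a.
elim: n => [|n IHn].
  by apply: (@filterS _ _ Fa setT) => [b _ j|]; [rewrite ltn0|exact: filterT].
have ban : nbhs a [set b : cantor_space | (b : nat -> bool) n = (a : nat -> bool) n].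
  have := @proj_continuous nat (fun=> bool) n a [set (a : nat -> bool) n].
  by apply; exact: discrete_set1.
apply: (@filterS2 _ _ Fa _ _ _ _ IHn ban) => b bn bna j.
rewrite ltnS leq_eqVlt => /predU1P[->|]; last exact: bn.
by rewrite /signs bna.
Qed.

Lemma continuous_coding_signs : continuous (fun a : cantor_space => coding (signs a)).
Proof.
move=> a; apply/cvgrPdist_le => e e0.
have [n ne] : exists n, 3^-1 ^+ n <= e.
  have c0 : 3^-1 ^+ n @[n --> \oo] --> (0 : R).
    by apply: cvg_expr; rewrite ger0_norm//; lra.
  have /cvgrPdist_le/(_ _ e0)[n _ /(_ n (leqnn n))/=] := c0.
  by rewrite sub0r normrN ger0_norm ?exprn_ge0//; exists n.
near=> b; apply: le_trans ne; apply: coding_near; [exact: Sigma_signs..|].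
by move=> j jn; apply/esym; move: j jn; near: b; exact: near_signs.
Unshelve. all: by end_near. Qed.

(** F pulled back along the coding, so that its continuity is tested in the product topology of the
    letters. *)
Definition matchF w z : R := if 0 < z then z * walk_at w (- ln z) else 0.

Lemma match_FE z c : cantor_set R c -> z <= 1 -> match_F z c = matchF (sigma c) z.
Proof.
move=> Cc z1; rewrite /match_F /matchF; case: ifP => // z0.
by rewrite match_q_walk_at// oppr_ge0 ln_le0.
Qed.

(** A walk satisfies |q(t)| <= t for t >= 0, so for z <= 1 the value is at most -z log z, that is 2
    r (- r log r) with r the square root of z. Uniformity in [w] gives continuity at z = 0. *)
Lemma matchF_le w z : Sigma w -> `|matchF w z| <= 2 * Num.sqrt z.
Proof.
move=> Sw; rewrite /matchF; case: ltP => z0; last by rewrite normr0 mulr_ge0// sqrtr_ge0.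
rewrite normrM gtr0_norm//.
have := @walk_tail _ w 0 (Num.truncn (- ln z)).+1 (- ln z) Sw isT.
rewrite /walk [X in _ - X]big_ord0 !subr0 => qle.
apply: (le_trans (ler_wpM2l (ltW z0) qle)).
set r := Num.sqrt z; have r0 : 0 < r by rewrite sqrtr_gt0.
have zE : z = r * r by rewrite -expr2 sqr_sqrtr// ltW.
have lE : - ln z = 2 * - ln r by rewrite zE lnM ?posrE//; ring.
(* From x <= exp x at x = -ln r, where exp x is 1/r. *)
have rl : r * - ln r <= 1.
  have <- : r * r^-1 = 1 by rewrite mulfV// lt0r_neq0.
  rewrite ler_pM2l// -[in leRHS](lnK (x := r)) ?posrE// -expRN.
  by apply: le_trans (expR_ge1Dx _); rewrite lerDr.
rewrite lE zE; case: (lerP 0 (2 * - ln r)) => l0.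
  have -> : r * r * (2 * - ln r) = 2 * r * (r * - ln r) by ring.
  by rewrite ler_piMr// mulr_ge0// ltW.
by rewrite mulr0 mulr_ge0// ltW.
Qed.

Lemma continuous_walk w n : Sigma w -> continuous (walk w n).
Proof.
move=> Sw t; apply/cvgrPdist_le => e e0.
have d0 : 0 < e / n.+1%:R by rewrite divr_gt0.
near=> s; apply: le_trans (walk_lipschitz _ _ _ Sw) _.
apply: (@le_trans _ _ (n.+1%:R * (e / n.+1%:R))); last by rewrite mulrC divfK.
rewrite ler_pM ?ler0n ?ler_nat//; near: s; exact: cvgr_dist_le.
Unshelve. all: by end_near. Qed.

Lemma continuous_matchF :
  continuous (fun p : R * cantor_space => matchF (signs p.2) p.1).
Proof.
move=> [z a].
change ((fun p : R * cantor_space => matchF (signs p.2) p.1) @ (z, a) --> matchF (signs a) z).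
have [z0|z0] := leP z 0.
  have -> : matchF (signs a) z = 0 by rewrite /matchF ltNge z0.
  have s0 : (fun p : R * cantor_space => 2 * Num.sqrt p.1) @ (z, a) --> 2 * Num.sqrt z.
    apply: cvgMl_tmp; apply: (@cvg_comp _ _ _ fst Num.sqrt _ (nbhs z)); first exact: cvg_fst.
    exact: sqrt_continuous.
  rewrite ler0_sqrtr// mulr0 in s0.
  apply/cvgrPdist_le => e e0; move/cvgrPdist_le: s0 => /(_ _ e0).
  apply: filterS => p; rewrite !sub0r !normrN; apply: le_trans.
  by apply: le_trans (matchF_le _ (Sigma_signs _)) _; exact: ler_norm.
(* For y > z/2 one has -ln y < n, so only the first n letters enter, and these are constant near
   [a]. *)
pose n := (Num.truncn (- ln (z / 2))).+1.
pose h y := y * walk (signs a) n (- ln y).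
have ch : {for z, continuous h}.
  apply: cvgM; first exact: cvg_id.
  apply: (@cvg_comp _ _ _ (fun y => - ln y) (walk (signs a) n) _ (nbhs (- ln z))).
    by apply: cvgN; exact: continuous_ln.
  by apply: continuous_walk; exact: Sigma_signs.
have hE : \forall p \near (z, a), matchF (signs p.2) p.1 = h p.1.
  have zz : \forall y \near z, z / 2 < y by apply: lt_nbhsr; lra.
  exists ([set y | z / 2 < y], [set b | forall j, (j < n)%N -> signs b j = signs a j]) => /=.
    by split=> //; exact: near_signs.
  move=> [y b] /= [zy ba]; rewrite /matchF /h ifT; last by apply: lt_trans zy; lra.
  rewrite (@walk_atE _ _ n); first by rewrite (eq_walk _ ba).
  rewrite /n; apply: le_trans (ltW (truncnS_gt _)).
  by rewrite lerN2 ler_ln ?posrE ?(ltW zy)//; lra.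
have : (fun p : R * cantor_space => h p.1) @ (z, a) --> h z.
  by apply: (@cvg_comp _ _ _ fst h _ (nbhs z)); [exact: cvg_fst|exact: ch].
rewrite -(nbhs_singleton hE)/=; apply: cvg_trans.
by apply: near_eq_cvg; apply: filterS hE => p ->.
Qed.

Lemma continuous_rV (X : topologicalType) n (f : X -> 'rV[R]_n.+1) :
  (forall i, continuous (fun p => f p 0 i)) -> continuous f.
Proof.
move=> cf p; apply/cvgrPdist_le => e e0; near=> q.
rewrite /Num.Def.normr/= mx_normrE (bigmax_le _ (ltW e0))//= => -[i j] _.
rewrite (ord1 i) {i} !mxE; move: j; near: q; apply: filter_forall => j.
by have /cvgrPdist_le := cf j p; exact.
Unshelve. all: by end_near. Qed.

(** Q is parametrized by z and the letters rather than by z and c, which avoids any continuity of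
    [sigma] on the Cantor set. *)
Lemma compact_ex_Q : compact (ex_Q R).
Proof.
pose f (p : R * cantor_space) : 'rV[R]_3 :=
  vec3 p.1 (coding (signs p.2)) (matchF (signs p.2) p.1).
have -> : ex_Q R = f @` (`[0, 1]%classic `*` setT).
  apply/seteqP; split=> _ [[z c] /= [z01 Cc] <-].
    case: (Cc) => w; rewrite -range_signs => -[a _ aw wc].
    exists (z, a) => //; rewrite /f/= aw wc match_FE//.
      by rewrite -wc sigmaK// -aw; exact: Sigma_signs.
    by move: z01; rewrite in_itv/= => /andP[].
  have Ca : cantor_set R (coding (signs c)) by exists (signs c) => //; exact: Sigma_signs.
  exists (z, coding (signs c)) => //=; rewrite match_FE//.
    by rewrite sigmaK//; exact: Sigma_signs.
  by move: z01; rewrite in_itv/= => /andP[].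
apply: continuous_compact; last first.
  apply: compact_setX; [exact: segment_compact|exact: cantor_space_compact].
apply: continuous_subspaceT; apply: continuous_rV; case=> -[|[|[|//]]] i3.
- rewrite (_ : (fun p => _) = fst); last by apply/funext => p; rewrite mxE.
  by move=> p; exact: cvg_fst.
- rewrite (_ : (fun p => _) = (fun a => coding (signs a)) \o snd); last first.
    by apply/funext => p; rewrite mxE.
  move=> p; apply: continuous_comp; first exact: cvg_snd.
  exact: continuous_coding_signs.
- rewrite (_ : (fun p => _) = (fun p => matchF (signs p.2) p.1)); last first.
    by apply/funext => p; rewrite mxE.
  exact: continuous_matchF.
Qed.

Lemma ex_Q_initial c : cantor_set R c -> ex_Q R (vec3 1 c 0).
Proof.
move=> Cc; exists (1, c); first by split=> //=; rewrite in_itv/= ler01 lexx.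
by rewrite match_FE// /matchF ltr01 ln1 oppr0 mul1r /walk_at walk0.
Qed.

Lemma compact_ex_K : compact (ex_K R).
Proof.
have -> : ex_K R = (fun a : cantor_space => vec3 1 (coding (signs a)) 0) @` setT.
  apply/seteqP; split=> _ [c + <-].
    by move=> [w]; rewrite -range_signs => -[a _ <-] <-; exists a.
  by move=> _; exists (coding (signs c)) => //; exists (signs c) => //; exact: Sigma_signs.
apply: continuous_compact; last exact: cantor_space_compact.
apply: continuous_subspaceT; apply: continuous_rV; case=> -[|[|[|//]]] i3.
- rewrite (_ : (fun p => _) = cst 1); last by apply/funext => p; rewrite mxE.
  exact: cst_continuous.
- rewrite (_ : (fun p => _) = (fun a => coding (signs a))); last first.
    by apply/funext => p; rewrite mxE.
  exact: continuous_coding_signs.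
- rewrite (_ : (fun p => _) = cst 0); last by apply/funext => p; rewrite mxE.
  exact: cst_continuous.
Qed.

Lemma compact_subsets_K : compact_subsets (ex_Q R) (ex_K R).
Proof.
split; [|exact: compact_ex_K|by move=> _ [c Cc <-]; exact: ex_Q_initial].
exists (vec3 1 (coding (fun=> 1)) 0), (coding (fun=> 1)) => //.
by exists (fun=> 1) => // j; right.
Qed.

Lemma compact_subsets_Kn n : compact_subsets (ex_Q R) (ex_Kn R n).
Proof.
split.
- exists (vec3 1 (coding (truncate n (fun=> 1))) 0), (coding (truncate n (fun=> 1))) => //.
  by rewrite cantor_approxE; exists (fun=> 1) => // j; right.
- apply: finite_compact; apply: finite_image.
  apply: (@sub_finite_set _ _ (range (fun b : n.-tuple bool => coding (word R b))));
    last exact: finite_image.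
  rewrite cantor_approxE => _ [w Sw <-]; have [b <-] := word_truncate n Sw.
  by exists b.
- by move=> _ [c Cc <-]; apply: ex_Q_initial; exact: cantor_approx_sub Cc.
Qed.

(** * The Hausdorff distance between K_n and K *)

Lemma euclidean_dist_vec3 z c c' y : euclidean_dist (vec3 z c y) (vec3 z c' y) = `|c - c'|.
Proof.
rewrite /euclidean_dist !big_ord_recl big_ord0 !mxE/= !subrr.
by rewrite expr0n/= !(add0r, addr0) sqrtr_sqr.
Qed.

Lemma dist_to_bound n (x y : 'rV[R]_n.+1) A : A y -> 0 <= dist_to x A <= euclidean_dist x y.
Proof.
move=> Ay; have lb0 : lbound [set euclidean_dist x y | y in A] 0.
  by move=> _ [u _ <-]; exact: sqrtr_ge0.
apply/andP; split.
  by apply: lb_le_inf => //; exists (euclidean_dist x y), y.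
by apply: ge_inf; [exists 0|exists y].
Qed.

Lemma sup_itv (E : set R) b : E !=set0 -> (forall x, E x -> 0 <= x <= b) -> 0 <= sup E <= b.
Proof.
move=> [x Ex] Eb; have ubE : ubound E b by move=> u /Eb/andP[].
apply/andP; split; last by apply: ge_sup => //; exists x.
apply: (@le_trans _ _ x); first by case/andP: (Eb _ Ex).
by apply: ub_le_sup => //; exists b.
Qed.

Lemma hausdorff_dist_le n (A B : set 'rV[R]_n.+1) e : A !=set0 -> B !=set0 ->
  (forall p, A p -> exists2 q, B q & euclidean_dist p q <= e) ->
  (forall q, B q -> exists2 p, A p & euclidean_dist q p <= e) ->
  0 <= hausdorff_dist A B <= e.
Proof.
have sup_dist (A' B' : set 'rV[R]_n.+1) : A' !=set0 ->
    (forall p, A' p -> exists2 q, B' q & euclidean_dist p q <= e) ->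
    0 <= sup [set dist_to x B' | x in A'] <= e.
  move=> [a Aa] AB; apply: sup_itv; first by exists (dist_to a B'), a.
  move=> _ [x Ax <-]; have [y By xy] := AB _ Ax.
  by have /andP[-> /le_trans->] := dist_to_bound x By.
move=> A0 B0 AB BA; have /andP[h1 h2] := sup_dist _ _ A0 AB.
have /andP[h3 h4] := sup_dist _ _ B0 BA.
by rewrite /hausdorff_dist le_max h1 ge_max h2.
Qed.

(** K_n lies in K, and truncating a sequence after n letters moves its code by at most 3^-n. *)
Lemma hausdorff_dist_Kn n : 0 <= hausdorff_dist (ex_Kn R n) (ex_K R) <= 3^-1 ^+ n.
Proof.
apply: hausdorff_dist_le.
- by case: (compact_subsets_Kn n).
- by case: compact_subsets_K.
- move=> _ [c Cc <-]; exists (vec3 1 c 0).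
    by exists c => //; exact: cantor_approx_sub Cc.
  by rewrite euclidean_dist_vec3 subrr normr0 exprn_ge0.
- move=> _ [_ [w Sw <-] <-]; exists (vec3 1 (coding (truncate n w)) 0).
    by exists (coding (truncate n w)) => //; rewrite cantor_approxE; exists w.
  rewrite euclidean_dist_vec3; apply: coding_near => //; first exact: Sigma_truncate.
  by move=> j jn; rewrite /truncate jn.
Qed.

Lemma cvg_hausdorff_dist_Kn :
  (fun n => hausdorff_dist (ex_Kn R n) (ex_K R)) @ \oo --> (0 : R).
Proof.
apply: (@squeeze_cvgr _ _ _ _ (cst 0) (fun n => 3^-1 ^+ n)).
- by apply: nearW => n; exact: hausdorff_dist_Kn.
- exact: cvg_cst.
- apply: cvg_expr; rewrite ger0_norm//; lra.
Qed.

End Compactness.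

Theorem theorem3p2 (R : realType) :
  [/\ compact (ex_Q R),
      compact_subsets (ex_Q R) (ex_K R) &
      forall n, (1 <= n)%N -> compact_subsets (ex_Q R) (ex_Kn R n)] /\
  [/\ (fun n => hausdorff_dist (ex_Kn R n) (ex_K R)) @ \oo --> (0 : R),
      (limn_einf (fun n => ex_h (ex_Kn R n) (ex_Q R)) < ex_h (ex_K R) (ex_Q R))%E,
      forall n, (1 <= n)%N -> ex_h (ex_Kn R n) (ex_Q R) = 0%E,
      ex_h (ex_K R) (ex_Q R) = (ln 2)%:E &
      ~ hausdorff_lower_semicontinuous (ex_Q R) (fun K' => ex_h K' (ex_Q R))].
Proof.
have cvgK := @cvg_hausdorff_dist_Kn R; have hK := @h_inv_K R.
have hKn n : ex_h (ex_Kn R n) (ex_Q R) = 0%E by exact: h_inv_Kn.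
have ln2 : 0 < ln 2 :> R by rewrite ln_gt0// ltr1n.
split; first by split=> [||n _];
  [exact: compact_ex_Q|exact: compact_subsets_K|exact: compact_subsets_Kn].
split=> // [|lsc].
  rewrite hK (_ : (fun n => _) = cst 0%E); last by apply/funext.
  by rewrite (cvg_limn_einf_sup (cvg_cst _)).1 lte_fin.
(* Any level strictly between the entropies 0 and [ln 2] would be violated; the midpoint is
   taken. *)
have [|e e0 eK] := lsc _ (ln 2 / 2) (@compact_subsets_K R).
  by rewrite hK lte_fin; lra.
have /cvgrPdist_lt/(_ _ e0)[n _ /(_ n (leqnn n))/=] := cvgK.
have /andP[d0 _] := @hausdorff_dist_Kn R n.
(* Semicontinuity at K puts K first in the distance, whereas the convergence puts K_n first;
   swapping the maximum reconciles them. *)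
rewrite sub0r normrN ger0_norm// {1}/hausdorff_dist maxC => dn.
have := eK _ (@compact_subsets_Kn R n) dn.
by rewrite hKn lte_fin; lra.
Qed.
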